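(* Let $\mathcal{G}$ be an acyclic directed mixed graph with vertex set $V$, and let $\mathbf{q}=(q_H(x_T): H\in\mathcal{H}(\mathcal{G}),\,x_T\in\{0,1\}^{T},\ T=\operatorname{tail}_{\mathcal{G}}(H))$ be a real vector. Then $\mathbf{q}$ is derived (i.e. $\mathbf{q}\in\mathcal{Q}_{\mathcal{G}}$) if and only if for each $x_V\in\{0,1\}^V$, $$p_{x_V}(\mathbf{q})\equiv\sum_{C:\,x_V^{-1}(0)\subseteq C\subseteq V}(-1)^{|C\setminus x_V^{-1}(0)|}\prod_{H\in[C]_{\mathcal{G}}}q_H(x_T)>0,$$ where $x_V^{-1}(0)=\{v\in V: x_v=0\}$.
   Context: **Graphs.** An acyclic directed mixed graph (ADMG) $\mathcal{G}$ consists of a finite vertex set $V$, a set of directed edges $v\to w$ ($v\neq w$) with no directed cycles, and a set of bidirected edges $v\leftrightarrow w$ (unordered pairs of distinct vertices); a pair may be joined by both a directed and a bidirected edge. For $A\subseteq V$, $\mathcal{G}_A$ is the induced subgraph on $A$. A path is a sequence of adjacent edges without repetition of a vertex (possibly empty). $\operatorname{pa}_{\mathcal{G}}(v)=\{w: w\to v\}$; $\operatorname{an}_{\mathcal{G}}(v)$ is the set of $w$ with a (possibly empty) directed path from $w$ to $v$, so $v\in\operatorname{an}_{\mathcal{G}}(v)$; $\operatorname{de}_{\mathcal{G}}(v)=\{w: v\in\operatorname{an}_{\mathcal{G}}(w)\}$; the district $\operatorname{dis}_{\mathcal{G}}(v)$ is the set of vertices joined to $v$ by a path consisting only of bidirected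 edges, including $v$. These are applied to sets by taking unions. $\operatorname{dis}_A$ means $\operatorname{dis}_{\mathcal{G}_A}$. $\operatorname{barren}_{\mathcal{G}}(B)=\{v\in B:\operatorname{de}_{\mathcal{G}}(v)\cap B=\{v\}\}$, and $B$ is barren if $B=\operatorname{barren}_{\mathcal{G}}(B)$. **Heads, tails, partition.** A (nonempty) set $H\subseteq V$ is a head if it is barren and is contained within a single district of $\mathcal{G}_{\operatorname{an}(H)}$; $\mathcal{H}(\mathcal{G})$ is the collection of heads. The tail of $H$ is $\operatorname{tail}_{\mathcal{G}}(H)=(\operatorname{dis}_{\operatorname{an}(H)}(H)\setminus H)\cup\operatorname{pa}_{\mathcal{G}}(\operatorname{dis}_{\operatorname{an}(H)}(H))$; it is denoted $T$ when $H$ is clear. For distinct heads, $H_i\prec H_j$ if $H_i\subseteq\operatorname{an}_{\mathcal{G}}(H_j)$. For $W\subseteq V$ let $\Phi_{\mathcal{G}}(W)$ be the set of heads $H\subseteq W$ such that $H\nprec H'$ for all other heads $H'\subseteq W$, and $\psi_{\mathcal{G}}(W)=W\setminus\bigcup_{C\in\Phi_{\mathcal{G}}(W)}C$. Define recursively $[\varnothing]_{\mathcal{G}}=\varnothing$ and $[W]_{\mathcal{G}}=\Phi_{\mathcal{G}}(W)\cup[\psi_{\mathcal{G}}(W)]_{\mathcal{G}}$. **Markov property.** A non-endpoint vertex on a path is a collider if both adjacent edges on the path have an arrowhead at it, and otherwise a non-collider. A path between $v,w$ is blocked by $C\subseteq V\setminus\{v,w\}$ if some non-collider on it is in $C$,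 or some collider on it is not in $\operatorname{an}_{\mathcal{G}}(C)$. Disjoint sets $A,B$ are m-separated given $C\subseteq V\setminus(A\cup B)$ if for all $a\in A$, $b\in B$ every path from $a$ to $b$ is blocked by $C$. A distribution satisfies the global Markov property for $\mathcal{G}$ if for all disjoint $A,B,C\subseteq V$ with $A,B$ nonempty, $A$ m-separated from $B$ given $C$ implies $X_A\perp\!\!\!\perp X_B\mid X_C$ ($C$ may be empty). **Model and derived parameters.** $\mathcal{P}_{\mathcal{G}}$ is the set of strictly positive probability distributions $\mathbf{p}$ on $\{0,1\}^V$ that obey the global Markov property with respect to $\mathcal{G}$. For $\mathbf{p}\in\mathcal{P}_{\mathcal{G}}$, $\mathbf{q}(\mathbf{p})$ is the vector with entries $q_H(x_T)=P(X_H=0\mid X_T=x_T)$, $H\in\mathcal{H}(\mathcal{G})$, $x_T\in\{0,1\}^T$, computed under $\mathbf{p}$. $\mathcal{Q}_{\mathcal{G}}=\mathbf{q}(\mathcal{P}_{\mathcal{G}})$ is the image, and its elements are called derived. Empty products equal 1.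
   Formalization: The recursion for $[W]_{\mathcal{G}}$ is taken with a union, $[W]_{\mathcal{G}}=\Phi_{\mathcal{G}}(W)\cup[\psi_{\mathcal{G}}(W)]_{\mathcal{G}}$, instead of the printed intersection, which would make every $[W]_{\mathcal{G}}$ empty and the claim false already for one vertex. *)

(* Defs.v *)
From HB Require Import structures.
From mathcomp Require Import all_boot all_order all_algebra.
From mathcomp Require Import reals.

Set Implicit Arguments.
Unset Strict Implicit.
Unset Printing Implicit Defensive.

Import Order.TTheory GRing.Theory Num.Theory.
Local Open Scope ring_scope.

(* [dir v w] is v -> w, [bi v w] is v <-> w.  Self-loops v -> v are excluded by
   acyclicity, since [cycle dir [:: v]] is [dir v v]. *)
Record admg (V : finType) := ADMG {
  dir : rel V;
  bi : rel V;
  dir_acyclic : forall (v : V) (s : seq V), ~~ cycle dir (v :: s);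
  bi_sym : symmetric bi;
  bi_irr : irreflexive bi
}.

Section Graph.
Variables (V : finType) (G : admg V).
Implicit Types (v w : V) (A B C H W : {set V}).

Definition pa v : {set V} := [set w | dir G w v].
Definition an v : {set V} := [set w | connect (dir G) w v].
Definition de v : {set V} := [set w | v \in an w].

Definition paS A : {set V} := \bigcup_(v in A) pa v.
Definition anS A : {set V} := \bigcup_(v in A) an v.

(* Bidirected edges of the induced subgraph on A. *)
Definition bi_in A : rel V := [rel v w | [&& v \in A, w \in A & bi G v w]].

(* District of v in the induced subgraph on A; it is empty if v \notin A. *)
Definition dis A v : {set V} := [set w in A | connect (bi_in A) v w].
Definition disS A B : {set V} := \bigcup_(v in B) dis A v.

Definition barren B : {set V} := [set v in B | de v :&: B == [set v]].

Definition is_head H : bool :=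
  [&& H != set0, H == barren H & [exists v in anS H, H \subset dis (anS H) v]].

Definition head := {H : {set V} | is_head H}.

Definition tail H : {set V} :=
  (disS (anS H) H :\: H) :|: paS (disS (anS H) H).

Definition prec H1 H2 : bool := (H1 != H2) && (H1 \subset anS H2).

Definition Phi W : {set head} :=
  [set H : head | (val H \subset W)
     && [forall H' : head, (val H' \subset W) && (H' != H) ==>
                           ~~ prec (val H) (val H')]].

Definition psi W : {set V} := W :\: \bigcup_(C in Phi W) val C.

(* The recursion [W] = Phi W :|: [psi W] needs at most #|W| unfoldings because
   psi W is a proper subset of a nonempty W: see [hpart0] and [hpartE]. *)
Fixpoint hpart_rec (n : nat) W : {set head} :=
  if n is n'.+1 then Phi W :|: hpart_rec n' (psi W) else set0.
Definition hpart W : {set head} := hpart_rec #|W| W.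

(* A path is its first vertex together with a sequence of steps; a step is the
   kind of the edge followed and the vertex reached.  The kind is needed since
   two vertices may be joined by both a directed and a bidirected edge. *)
Inductive edge_kind := Forward | Backward | Bidirected.

Definition joins (k : edge_kind) v w : bool :=
  match k with
  | Forward => dir G v w
  | Backward => dir G w v
  | Bidirected => bi G v w
  end.

Definition arrow_at_source (k : edge_kind) : bool :=
  if k is Forward then false else true.
Definition arrow_at_target (k : edge_kind) : bool :=
  if k is Backward then false else true.

Fixpoint walk v (s : seq (edge_kind * V)) : bool :=
  if s is (k, w) :: s' then joins k v w && walk w s' else true.

Definition is_path v (s : seq (edge_kind * V)) : bool :=
  walk v s && uniq (v :: unzip2 s).

Definition endpoint v (s : seq (edge_kind * V)) : V := last v (unzip2 s).

Fixpoint blocked C (s : seq (edge_kind * V)) : bool :=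
  match s with
  | (k, v) :: (((k', _) :: _) as s') =>
      (if arrow_at_target k && arrow_at_source k' then v \notin anS C
       else v \in C)
      || blocked C s'
  | _ => false
  end.

Definition msep A B C : Prop :=
  forall (a b : V) (s : seq (edge_kind * V)),
    a \in A -> b \in B -> is_path a s -> endpoint a s = b -> blocked C s.

End Graph.

(* States: [false] stands for 0 and [true] for 1. *)
Definition state (T : finType) := {ffun T -> bool}.

Section Model.
Variables (R : realType) (V : finType) (G : admg V).
Implicit Types (A B C H : {set V}) (p : state V -> R) (x : state V).

Definition restrict A x : state {v : V | v \in A} :=
  [ffun v : {v : V | v \in A} => x (val v)].

Definition prob p (E : {set state V}) : R := \sum_(x in E) p x.
Definition cond_prob p (E F : {set state V}) : R := prob p (E :&: F) / prob p F.

(* The event X_A = x_A. *)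
Definition event A (xA : state {v : V | v \in A}) : {set state V} :=
  [set y | restrict A y == xA].

(* X_A _||_ X_B | X_C.  For disjoint A, B, C the values x_A, x_B, x_C are
   exactly the restrictions of the states x of V.  When P(X_C = x_C) = 0 both
   sides are 0. *)
Definition cond_indep p A B C : Prop :=
  forall x : state V,
    let EA := event (restrict A x) in
    let EB := event (restrict B x) in
    let EC := event (restrict C x) in
    cond_prob p (EA :&: EB) EC = cond_prob p EA EC * cond_prob p EB EC.

Definition global_markov p : Prop :=
  forall A B C : {set V},
    [disjoint A & B] -> [disjoint A & C] -> [disjoint B & C] ->
    A != set0 -> B != set0 -> msep G A B C -> cond_indep p A B C.

Definition in_model p : Prop :=
  [/\ forall x, 0 < p x, \sum_x p x = 1 & global_markov p].

(* Vectors (q_H(x_T)), H a head and x_T a state of its tail T. *)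
Definition params :=
  forall H : head G, state {v : V | v \in tail G (val H)} -> R.

Definition zero_event H : {set state V} := [set y : state V | [forall v in H, ~~ y v]].

Definition params_of p : params :=
  fun (H : head G) xT => cond_prob p (zero_event (val H)) (event xT).

Definition derived (q : params) : Prop :=
  exists2 p : state V -> R, in_model p & forall (H : head G) xT, q H xT = params_of p xT.

Definition zeros x : {set V} := [set v | ~~ x v].

Definition prob_of (q : params) x : R :=
  \sum_(C : {set V} | zeros x \subset C)
    (-1) ^+ #|C :\: zeros x| *
    \prod_(H in hpart G C) q H (restrict (tail G (val H)) x).

End Model.

Section PartitionRecursion.
Variables (V : finType) (G : admg V).
Implicit Types (v w : V) (A B C H W : {set V}).

Lemma an_refl v : v \in an G v.
Proof. by rewrite inE connect0. Qed.

Lemma sub_anS A : A \subset anS G A.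
Proof. by apply/subsetP=> v vA; apply/bigcupP; exists v; rewrite ?an_refl. Qed.

Lemma anS_sub A B : A \subset anS G B -> anS G A \subset anS G B.
Proof.
move=> /subsetP sAB; apply/subsetP=> v /bigcupP[w /sAB /bigcupP[u uB]].
rewrite !inE => wu vw; apply/bigcupP; exists u => //.
by rewrite inE; apply: connect_trans vw wu.
Qed.

Lemma connect_dir_anti v w :
  connect (dir G) v w -> connect (dir G) w v -> v = w.
Proof.
move=> /connectP[s sp sl] /connectP[t tp tl].
have stp : path (dir G) v (s ++ t) by rewrite cat_path sp -sl tp.
have stl : last v (s ++ t) = v by rewrite last_cat -sl.
case/lastP E: (s ++ t) stp stl => [|u z].
  by case: s sl E {sp} => //= ->.
rewrite last_rcons => up zv; rewrite zv in up.
by have /negP[] := dir_acyclic G v u.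
Qed.

Lemma head1 v : is_head G [set v].
Proof.
have vv : v \in anS G [set v] by apply: (subsetP (sub_anS _)); rewrite set11.
apply/and3P; split; first by apply/set0Pn; exists v; rewrite set11.
  apply/eqP/setP=> w; rewrite !inE; case: eqP => //= ->.
  by apply/esym/eqP/setIidPr; rewrite sub1set !inE connect0.
by apply/existsP; exists v; rewrite vv sub1set inE vv connect0.
Qed.

Lemma head_anS_sub H1 H2 : is_head G H1 -> anS G H1 = anS G H2 -> H1 \subset H2.
Proof.
move=> /and3P[_ /eqP b1 _] e; apply/subsetP=> v v1.
have /bigcupP[w w2] : v \in anS G H2 by rewrite -e (subsetP (sub_anS _)).
rewrite inE => vw.
have /bigcupP[u u1] : w \in anS G H1 by rewrite e (subsetP (sub_anS _)).
rewrite inE => wu.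
have : v \in barren G H1 by rewrite -b1.
rewrite inE => /andP[_ /eqP/setP/(_ u)].
rewrite !inE u1 andbT (connect_trans vw wu) => /esym/eqP uv.
by rewrite (@connect_dir_anti v w) // -uv.
Qed.

Lemma psi_proper W : W != set0 -> psi G W \proper W.
Proof.
move=> /set0Pn[v vW].
pose P := [pred H : head G | val H \subset W].
have Pv : P (Sub [set v] (head1 v)) by rewrite /= sub1set.
case: (arg_maxnP (fun H : head G => #|anS G (val H)|) Pv) => H HW Hmax.
have HPhi : H \in Phi G W.
  rewrite inE; apply/andP; split; first exact: HW.
  apply/forallP=> H'; apply/implyP=> /andP[H'W neH].
  apply/negP=> /andP[_ /anS_sub sub].
  have e : anS G (val H) = anS G (val H').
    by apply/eqP; rewrite eqEcard sub; apply: Hmax.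
  case/eqP: neH; apply/val_inj/eqP; rewrite eqEsubset.
  by rewrite !head_anS_sub ?(valP H) ?(valP H').
have /and3P[/set0Pn[w wH] _ _] := valP H.
apply/properP; split; first exact: subsetDl.
exists w; first exact: (subsetP HW).
by rewrite inE negb_and negbK; apply/orP; left; apply/bigcupP; exists H.
Qed.

Lemma hpart0 : hpart G set0 = set0.
Proof. by rewrite /hpart cards0. Qed.

Lemma Phi0 : Phi G set0 = set0.
Proof.
apply/setP=> H; rewrite !inE subset0.
by have /and3P[/negPf-> _ _] := valP H.
Qed.

Lemma hpart_rec_fuel n W : (#|W| <= n)%N -> hpart_rec G n W = hpart G W.
Proof.
rewrite /hpart; elim/ltn_ind: n W => -[|n] IHn W.
  by rewrite leqn0 => /eqP->.
have [->|W0] := eqVneq W set0 => [_|leW].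
  rewrite cards0 /= Phi0 set0U /psi set0D.
  by rewrite IHn ?cards0.
have := proper_card (psi_proper W0).
case E: #|W| => [//|m] lt /=; rewrite E in leW; congr (_ :|: _).
have len : (#|psi G W| <= n)%N by exact: leq_trans lt leW.
by rewrite (IHn n) ?(IHn m).
Qed.

Lemma hpartE W : hpart G W = Phi G W :|: hpart G (psi G W).
Proof.
have [->|W0] := eqVneq W set0.
  by rewrite /psi set0D hpart0 Phi0 setU0.
have := proper_card (psi_proper W0); rewrite [LHS]/hpart.
by case: #|W| => [//|m] lt /=; rewrite hpart_rec_fuel.
Qed.

End PartitionRecursion.

(* Main.v *)
Require Import Defs.
From mathcomp Require Import all_boot all_order all_algebra.
From mathcomp Require Import reals boolp.
Import Order.TTheory GRing.Theory Num.Theory.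
Local Open Scope ring_scope.

Set Implicit Arguments.
Unset Strict Implicit.
Unset Printing Implicit Defensive.

(** The proof compares, over every ancestral set A, the margin of a distribution
    on A with the signed expansion
      F_A(x) = \sum_(C \subset A) wt x A C * \prod_(H in [C]) q_H(x_T),
    which for A = V is p_x(q).  The weights are products over the vertices of A,
    and [C1 :|: C2] is the union of [C1] and [C2] as soon as every head inside
    C1 :|: C2 lies in C1 or in C2; this rests on the confluence of the recursion
    defining [C]: maximal heads of a set are disjoint, so they may be removed in
    any order ([hpart_remove_Phi]).  Three facts about F follow.
    - F_A is the product of its values on the districts of A ([expansionU]), and
      the factor of a district D involves only the coordinates in D and in its
      parents ([expansion_agree]).
    - If v has no child in A, adding F_A over the two values of x_v gives
      F_(A - v), because v is in no tail ([expansion_marg]).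
    - If x vanishes on a head H and A = an(H), then
      F_A(x) = q_H(x_T) F_(A - H)(x), because H is the maximal head of every set
      between H and A ([expansion_head]).

    Sufficiency.  Put p_x = p_x(q).  By the second fact the margins of p over
    ancestral sets are the F_A, whence the total mass 1 and, with the third fact,
    the conditional probabilities q_H.  For the global Markov property let A and
    B be m-separated by C, let M = an(A, B, C), and let S be the set of vertices
    of M outside C that are reached from A by walks that C does not block.  Then
    B misses S, and a district of M that contains a vertex of S or a child of one
    lies, with its parents, inside S :|: C.  By the first fact
    F_M = g(x_(S :|: C)) h(x_(M - S)), and such a factorization gives the
    conditional independence of A and B given C ([factor_indep]).  That S works
    combines two classical arguments on mixed graphs: a collider that is only an
    ancestor of A or B can be replaced by a directed path to A or B, and an
    unblocked walk can be shortened to an unblocked path ([msep_walk]).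

    Necessity.  For p in the model, vertices without children in an ancestral set
    A are independent of the remaining vertices of A given their Markov blanket
    ([local_markov]).  Induction on #|A| then shows that the margin of p over A is
    F_A: choose v without children in A, with district D.  If an(D) is smaller
    than A, the conditional law of x_v in A is the one in an(D), known by
    induction.  If an(D) = A, the barren vertices of D form a head H with
    an(H) = A; by the second fact it suffices to treat the x vanishing on H,
    where the third fact and the local Markov property agree.  Taking A = V,
    p_x(q) = p(x) > 0. *)

(** * Ancestral sets, districts and heads *)

Section Ancestral.
Variables (V : finType) (G : admg V).
Implicit Types (u v w : V) (A B C D H W : {set V}).

Definition ancestral A := forall v w, dir G v w -> w \in A -> v \in A.

Definition childless A v := forall w, w \in A -> ~~ dir G v w.

(** D is a union of districts of the subgraph induced on A. *)
Definition bi_closed A D :=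
  D \subset A /\ forall v w, v \in D -> w \in A -> bi G v w -> w \in D.

Lemma anSP A v :
  reflect (exists2 w, w \in A & connect (dir G) v w) (v \in anS G A).
Proof.
apply: (iffP bigcupP) => -[w wA]; first by rewrite inE; exists w.
by move=> vw; exists w; rewrite ?inE.
Qed.

Lemma ancestral_connect A v w :
  ancestral A -> connect (dir G) v w -> w \in A -> v \in A.
Proof.
move=> ancA /connectP[s sp ->]; elim: s v sp => //= u s IHs v /andP[vu us].
by move/(IHs _ us); apply: ancA.
Qed.

Lemma ancestral_anS A : ancestral (anS G A).
Proof.
move=> v w vw /anSP[u uA wu]; apply/anSP; exists u => //.
exact: connect_trans (connect1 vw) wu.
Qed.

Lemma ancestralT : ancestral setT.
Proof. by move=> v w; rewrite !inE. Qed.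

Lemma anS_min A B : ancestral A -> B \subset A -> anS G B \subset A.
Proof.
move=> ancA sBA; apply/subsetP=> v /anSP[w wB vw].
exact: ancestral_connect ancA vw (subsetP sBA _ wB).
Qed.

Lemma dir_irr v : dir G v v = false.
Proof. by apply/negP=> vv; have := dir_acyclic G v [::]; rewrite /= vv. Qed.

(** The number of ancestors serves as a topological order. *)
Lemma card_an_lt v w : dir G v w -> (#|an G v| < #|an G w|)%N.
Proof.
move=> vw; apply: proper_card; apply/properP; split.
  apply/subsetP=> u; rewrite !inE => uv.
  exact: connect_trans uv (connect1 vw).
exists w; first exact: an_refl.
rewrite inE; apply/negP=> wv.
by have := vw; rewrite (connect_dir_anti (connect1 vw) wv) dir_irr.
Qed.

Lemma exists_childless A :
  A != set0 -> exists2 v, v \in A & childless A v.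
Proof.
move=> /set0Pn[v0 v0A].
case: (arg_maxnP (fun v => #|an G v|) v0A) => v vA vmax.
exists v => // w wA; apply/negP=> /card_an_lt.
by rewrite ltnNge; apply/negP; rewrite negbK; apply: vmax.
Qed.

Lemma ancestralD1 A v : ancestral A -> childless A v -> ancestral (A :\ v).
Proof.
move=> ancA chv u w uw; rewrite !in_setD1 => /andP[_ wA].
rewrite (ancA _ _ uw wA) andbT; apply/eqP=> uv.
by have := chv _ wA; rewrite -uv uw.
Qed.

Lemma ancestralD A H :
  ancestral A -> (forall h, h \in H -> childless A h) -> ancestral (A :\: H).
Proof.
move=> ancA chH u w uw; rewrite !in_setD => /andP[_ wA].
rewrite (ancA _ _ uw wA) andbT; apply/negP=> uH.
by have := chH _ uH _ wA; rewrite uw.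
Qed.

Lemma exists_ancestralU1 A :
  ancestral A -> A != setT ->
  exists v, [/\ v \notin A, ancestral (v |: A) & childless (v |: A) v].
Proof.
move=> ancA; rewrite -subTset => /subsetPn[v0 _ v0A].
(* By minimality the parents of the new vertex are in A. *)
case: (arg_minnP (P := [pred v | v \notin A]) (fun v => #|an G v|) v0A).
move=> v vA vmin; exists v; split=> //.
  move=> u w uw; rewrite !in_setU1 => /orP[/eqP wv|wA]; last first.
    by rewrite (ancA _ _ uw wA) orbT.
  apply/orP; right; apply/negPn/negP=> uA.
  by have := vmin _ uA; rewrite leqNgt card_an_lt // -wv.
move=> w; rewrite in_setU1 => /orP[/eqP->|wA]; first by rewrite dir_irr.
by apply: contra vA => vw; apply: ancA vw wA.
Qed.

Lemma bi_in_sym A : connect_sym (bi_in G A).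
Proof.
apply: sym_connect_sym => v w; rewrite /bi_in /= bi_sym.
by case: (v \in A); case: (w \in A).
Qed.

Lemma bi_in_connect_closed A B D v w :
  bi_closed A D -> B \subset A -> connect (bi_in G B) v w ->
  v \in D -> w \in D.
Proof.
move=> [_ cl] sBA /connectP[s sp ->].
elim: s v sp => //= u s IHs v /andP[/and3P[_ uB vu] us] vD.
by apply: IHs us _; apply: cl vD _ vu; apply: (subsetP sBA).
Qed.

Lemma bi_in_subconnect A B v w :
  A \subset B -> connect (bi_in G A) v w -> connect (bi_in G B) v w.
Proof.
move=> /subsetP sAB; apply: connect_sub => x y /and3P[xA yA xy].
by apply: connect1; rewrite /bi_in /= !sAB.
Qed.

Lemma disS_closed A H : bi_closed A (disS G A H).
Proof.
split; first by apply/bigcupsP=> v _; apply/subsetP=> w; rewrite inE => /andP[].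
move=> v w /bigcupP[u uH]; rewrite inE => /andP[vA uv] wA vw.
apply/bigcupP; exists u => //; rewrite inE wA /=.
by apply: connect_trans uv (connect1 _); rewrite /bi_in /= vA wA.
Qed.

Lemma disS1 A v : disS G A [set v] = dis G A v.
Proof. by rewrite /disS big_set1. Qed.

Lemma sub_disS A H : H \subset A -> H \subset disS G A H.
Proof.
move=> /subsetP sHA; apply/subsetP=> h hH; apply/bigcupP; exists h => //.
by rewrite inE sHA //= connect0.
Qed.

Lemma disS_min A B D H :
  bi_closed A D -> B \subset A -> H \subset D -> disS G B H \subset D.
Proof.
move=> clD sBA /subsetP sHD; apply/bigcupsP=> h /sHD hD.
apply/subsetP=> w; rewrite inE => /andP[_ hw].
exact: bi_in_connect_closed clD sBA hw hD.
Qed.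

Lemma is_headP H : is_head G H ->
  [/\ H != set0, H = barren G H &
      forall h k, h \in H -> k \in H -> connect (bi_in G (anS G H)) h k].
Proof.
case/and3P=> H0 /eqP bH /exists_inP[v _ /subsetP sH]; split=> // h k hH kH.
have := sH h hH; have := sH k kH; rewrite !inE => /andP[_ vk] /andP[_ vh].
by apply: connect_trans vk; rewrite bi_in_sym.
Qed.

Lemma barrenP B v :
  reflect (v \in B /\ forall w, w \in B -> connect (dir G) v w -> w = v)
          (v \in barren G B).
Proof.
rewrite inE; apply: (iffP andP) => -[vB].
  move=> /eqP/setP e; split=> // w wB vw; apply/eqP.
  by have := e w; rewrite !inE wB vw => <-.
move=> bv; split=> //; apply/eqP/setP=> w; rewrite !inE.
apply/andP/eqP => [[vw wB]|->]; first exact: bv.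
by rewrite connect0.
Qed.

Lemma barren_sub B : barren G B \subset B.
Proof. by apply/subsetP=> v /barrenP[]. Qed.

Lemma barren_childless B v : v \in barren G B -> childless (anS G B) v.
Proof.
move=> /barrenP[vB bv] w /anSP[u uB wu]; apply/negP=> vw.
have uv := bv _ uB (connect_trans (connect1 vw) wu); rewrite uv in wu.
by have := vw; rewrite (connect_dir_anti (connect1 vw) wu) dir_irr.
Qed.

Lemma head_childless H h : is_head G H -> h \in H -> childless (anS G H) h.
Proof. by case/is_headP=> _ bH _ hH; apply: barren_childless; rewrite -bH. Qed.

Lemma anS_barren B : anS G (barren G B) = anS G B.
Proof.
apply/eqP; rewrite eqEsubset; apply/andP; split; apply: anS_sub.
  exact: subset_trans (barren_sub B) (sub_anS G B).
apply/subsetP=> v vB.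
have Pv : [pred w in B | connect (dir G) v w] v by rewrite /= vB connect0.
case: (arg_maxnP (fun w => #|an G w|) Pv) => w /andP[wB vw] wmax.
apply/anSP; exists w => //; apply/barrenP; split=> // u uB wu.
have /= := wmax u; rewrite uB (connect_trans vw wu) => /(_ isT) le.
apply/esym; apply: (connect_dir_anti wu).
suff : u \in an G w by rewrite inE.
suff -> : an G w = an G u by apply: an_refl.
apply/eqP; rewrite eqEcard le andbT; apply/subsetP=> z; rewrite !inE => zw.
exact: connect_trans zw wu.
Qed.

Lemma barren_idem B : barren G (barren G B) = barren G B.
Proof.
apply/eqP; rewrite eqEsubset barren_sub; apply/subsetP=> v vb.
apply/barrenP; split=> // w wb; case/barrenP: vb => _; apply.
exact: (subsetP (barren_sub B)).
Qed.

Lemma barren_head B :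
  B != set0 ->
  (forall v w, v \in B -> w \in B -> connect (bi_in G (anS G B)) v w) ->
  is_head G (barren G B).
Proof.
move=> /set0Pn[v vB] conn; apply/and3P; split; last 1 first.
- apply/exists_inP; exists v; rewrite anS_barren ?(subsetP (sub_anS _ _)) //.
  apply/subsetP=> w /(subsetP (barren_sub B)) wB.
  by rewrite inE (subsetP (sub_anS _ _)) //=; apply: conn.
- have : v \in anS G (barren G B).
    by rewrite anS_barren (subsetP (sub_anS _ _)).
  by case/anSP=> w wb _; apply/set0Pn; exists w.
- by rewrite barren_idem.
Qed.

(** Two vertices of a head H are joined by bidirected edges inside an(H), hence
    inside A, and such a path cannot leave D. *)
Lemma head_side A D H :
  ancestral A -> bi_closed A D -> is_head G H -> H \subset A ->
  H \subset D \/ [disjoint H & D].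
Proof.
move=> ancA clD /is_headP[_ _ conn] sHA.
have [dj|] := boolP [disjoint H & D]; first by right.
rewrite -setI_eq0 => /set0Pn[h /setIP[hH hD]]; left; apply/subsetP=> k kH.
by apply: (bi_in_connect_closed clD (anS_min ancA sHA) (conn _ _ hH kH)).
Qed.

Lemma tail_sub A D H :
  ancestral A -> bi_closed A D -> H \subset D ->
  tail G H \subset D :|: paS G D.
Proof.
move=> ancA clD sHD.
have sHA : H \subset A by case: clD => sDA _; apply: subset_trans sHD sDA.
have sD := disS_min clD (anS_min ancA sHA) sHD.
rewrite /tail setUSS //; first exact: subset_trans (subsetDl _ _) sD.
apply/bigcupsP=> v vD; apply: bigcup_sup; exact: (subsetP sD).
Qed.

(** Tails consist of proper ancestors of the head. *)
Lemma childless_tail A H v :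
  ancestral A -> H \subset A -> childless A v -> v \notin tail G H.
Proof.
move=> ancA sHA chv; have /subsetP sA := anS_min ancA sHA.
have [/subsetP sD _] := disS_closed (anS G H) H.
rewrite !inE negb_or negb_and negbK; apply/andP; split.
  have [//|vH /=] := boolP (v \in H); apply/negP=> /sD /anSP[h hH].
  case/connectP=> -[/= _ hv|w s /= /andP[vw ws] e]; first by rewrite -hv hH in vH.
  have /chv : w \in A by apply/sA/anSP; exists h => //; apply/connectP; exists s.
  by rewrite vw.
apply/negP=> /bigcupP[d /sD /sA dA]; rewrite inE => vd.
by have := chv _ dA; rewrite vd.
Qed.

(** A head contains no parent of its district, so the tail is the Markov
    blanket of H within an(H). *)
Lemma tailE H : is_head G H ->
  tail G H = (disS G (anS G H) H :|: paS G (disS G (anS G H) H)) :\: H.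
Proof.
move=> hH; set D := disS _ _ _; rewrite /tail -/D setDUl; congr (_ :|: _).
apply/esym/setDidPl; rewrite disjoint_sym disjoints_subset.
apply/subsetP=> h hhH; rewrite inE; apply/negP=> /bigcupP[d dD].
have [/subsetP/(_ d dD) dA _] := disS_closed (anS G H) H.
by rewrite inE => hd; have := head_childless hH hhH dA; rewrite hd.
Qed.

End Ancestral.

(** * Confluence of the partition into heads *)

Section HeadPartition.
Variables (V : finType) (G : admg V).
Implicit Types (u v w : V) (A B C D W : {set V}) (H K : Defs.head G).

Lemma PhiP W H :
  reflect (val H \subset W /\
           forall K, val K \subset W -> val H \subset anS G (val K) -> K = H)
          (H \in Phi G W).
Proof.
rewrite inE; apply: (iffP andP) => -[HW].
  move=> /forallP maxH; split=> // K KW HK; apply/eqP/negPn/negP=> neKH.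
  have := maxH K; rewrite KW neKH /= /prec HK andbT negbK => /eqP/val_inj e.
  by rewrite e eqxx in neKH.
move=> maxH; split=> //; apply/forallP=> K; apply/implyP=> /andP[KW neKH].
by apply/negP=> /andP[_ /(maxH _ KW) e]; rewrite e eqxx in neKH.
Qed.

Lemma head_neq0 H : val H != set0.
Proof. by have [] := is_headP (valP H). Qed.

Lemma Phi_sub W W' H :
  W' \subset W -> val H \subset W' -> H \in Phi G W -> H \in Phi G W'.
Proof.
move=> sW sH /PhiP[_ maxH]; apply/PhiP; split=> // K KW.
by apply: maxH; apply: subset_trans KW sW.
Qed.

Lemma Phi_neq0 W : W != set0 -> exists H, H \in Phi G W.
Proof.
move=> /(psi_proper G)/properP[_ [v vW]]; rewrite in_setD vW andbT negbK.
by case/bigcupP=> H HW _; exists H.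
Qed.

(** The union of two intersecting heads is joined by bidirected paths through a
    common vertex, so its barren part is a head; it lies above both, and
    maximality makes all three equal. *)
Lemma Phi_disjoint W H K :
  H \in Phi G W -> K \in Phi G W -> H != K -> [disjoint val H & val K].
Proof.
move=> /PhiP[HW maxH] /PhiP[KW maxK]; apply: contraNT.
rewrite -setI_eq0 => /set0Pn[v /setIP[vH vK]].
have [_ _ connH] := is_headP (valP H); have [_ _ connK] := is_headP (valP K).
pose B := val H :|: val K.
have connv w : w \in B -> connect (bi_in G (anS G B)) v w.
  have sub (L : {set V}) : L \subset B -> anS G L \subset anS G B.
    by move=> sL; apply: anS_sub; apply: subset_trans sL (sub_anS _ _).
  case/setUP=> wL; [move: (connH v w vH wL)|move: (connK v w vK wL)];
  by apply: bi_in_subconnect; apply: sub; rewrite ?subsetUl ?subsetUr.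
have hB : is_head G (barren G B).
  apply: barren_head; first by apply/set0Pn; exists v; rewrite inE vH.
  by move=> w u wB uB; rewrite (connect_trans _ (connv u uB)) // bi_in_sym connv.
pose L : Defs.head G := exist _ (barren G B) hB.
have LW : val L \subset W.
  by apply: subset_trans (barren_sub _ _) _; rewrite subUset HW.
have sB : B \subset anS G (val L) by rewrite /= anS_barren sub_anS.
have eH := maxH L LW (subset_trans (subsetUl _ _) sB).
have eK := maxK L LW (subset_trans (subsetUr _ _) sB).
by apply/eqP; exact: etrans (esym eH) eK.
Qed.

(** Confluence: removing only some of the maximal heads leaves the others maximal,
    because they are disjoint from the removed ones. *)
Lemma hpart_remove_Phi W (S : {set Defs.head G}) :
  S \subset Phi G W -> hpart G W = S :|: hpart G (W :\: \bigcup_(H in S) val H).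
Proof.
elim/ltn_ind: #|W| {-2}W (erefl #|W|) S => n IHn {}W cardW S sS.
have [->|S0] := eqVneq S set0; first by rewrite big_set0 setD0 set0U.
set W' := W :\: _.
have sSW : \bigcup_(H in S) val H \subset W.
  by apply/bigcupsP=> H /(subsetP sS)/PhiP[].
have ltW : (#|W'| < n)%N.
  have [H HS] := set0Pn _ S0; have [v vH] := set0Pn _ (head_neq0 H).
  rewrite -cardW; apply: proper_card; apply/properP; split.
    exact: subsetDl.
  have vS : v \in \bigcup_(H in S) val H by apply/bigcupP; exists H.
  by exists v; [apply: (subsetP sSW)|rewrite !inE vS].
rewrite (IHn _ ltW W' erefl (Phi G W :\: S)); last first.
  apply/subsetP=> H /setDP[HW HS]; apply: Phi_sub (HW); first exact: subsetDl.
  have /PhiP[sHW _] := HW; rewrite subsetD sHW /=.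
  apply/bigcup_disjointP => K KS; apply: Phi_disjoint HW (subsetP sS _ KS) _.
  by apply: contraNneq HS => ->.
have eS : S :|: (Phi G W :\: S) = Phi G W by rewrite -{1}(setIidPr sS) setID.
by rewrite setUA eS [LHS]hpartE /W' setDDl -bigcup_setU eS.
Qed.

Lemma hpart_sub W H : H \in hpart G W -> val H \subset W.
Proof.
elim/ltn_ind: #|W| {-2}W (erefl #|W|) => n IHn {}W cardW.
have [->|W0] := eqVneq W set0; first by rewrite hpart0 inE.
rewrite hpartE => /setUP[/PhiP[]//|HW]; apply: subset_trans (subsetDl _ _).
have lt : (#|psi G W| < n)%N by rewrite -cardW; apply/proper_card/psi_proper.
exact: (IHn _ lt (psi G W) erefl HW).
Qed.

Lemma hpart_remove W H :
  H \in Phi G W ->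
  hpart G W = H |: hpart G (W :\: val H) /\ H \notin hpart G (W :\: val H).
Proof.
move=> HW; split; first by rewrite (@hpart_remove_Phi _ [set H]) ?sub1set // big_set1.
apply/negP=> /hpart_sub; rewrite subsetD => /andP[_].
by rewrite -setI_eq0 setIid (negPf (head_neq0 H)).
Qed.

(** A head K above H inside an(H) has the same ancestors as H, and a barren set is
    determined by its ancestors. *)
Lemma Phi_anS H C : val H \subset C -> C \subset anS G (val H) -> H \in Phi G C.
Proof.
move=> HC CA; apply/PhiP; split=> // K KC HK.
have [_ bH _] := is_headP (valP H); have [_ bK _] := is_headP (valP K).
have e : anS G (val K) = anS G (val H).
  by apply/eqP; rewrite eqEsubset !anS_sub // (subset_trans KC CA).
apply/val_inj/eqP; rewrite eqEsubset (head_anS_sub (valP K) e).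
exact: head_anS_sub (valP H) (esym e).
Qed.

End HeadPartition.

(** * Agreement of states *)

Section States.
Variables (V : finType).
Implicit Types (u v w : V) (A B C D W : {set V}) (x y z : state V).

Definition agree A x y := [forall v in A, x v == y v].

Lemma agreeP A x y : reflect {in A, x =1 y} (agree A x y).
Proof. exact: eqfun_inP. Qed.

Lemma agree_refl A x : agree A x x.
Proof. exact/agreeP. Qed.

Lemma agree_sym A x y : agree A x y = agree A y x.
Proof. by apply/agreeP/agreeP=> e v vA; rewrite e. Qed.

Lemma agree_trans A y x z : agree A x y -> agree A y z -> agree A x z.
Proof. by move=> /agreeP e1 /agreeP e2; apply/agreeP=> v vA; rewrite e1 ?e2. Qed.

Lemma agree_sub A B x y : A \subset B -> agree B x y -> agree A x y.
Proof.
by move=> /subsetP s /agreeP e; apply/agreeP=> v vA; apply/e/s.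
Qed.

Lemma agreeU A B x y : agree (A :|: B) x y = agree A x y && agree B x y.
Proof.
apply/agreeP/andP=> [e|[/agreeP eA /agreeP eB] v].
  by split; apply/agreeP=> v vA; apply: e; rewrite inE vA ?orbT.
by case/setUP; [apply: eA|apply: eB].
Qed.

Lemma agreeT x y : agree setT x y = (x == y).
Proof.
apply/agreeP/eqP=> [e|->//]; apply/ffunP=> v; exact: e.
Qed.

Lemma restrict_agree A x y : (restrict A x == restrict A y) = agree A x y.
Proof.
apply/eqP/agreeP=> [e v vA|e]; last by apply/ffunP=> -[v vA]; rewrite !ffunE; apply: e.
by have /ffunP/(_ (exist _ v vA)) := e; rewrite !ffunE.
Qed.

Lemma agree_restrict A x y : agree A x y -> restrict A x = restrict A y.
Proof. by rewrite -restrict_agree => /eqP. Qed.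

Definition upd x v b : state V := [ffun u => if u == v then b else x u].

Lemma updE x v b : upd x v b v = b.
Proof. by rewrite ffunE eqxx. Qed.

Lemma upd_id x v : upd x v (x v) = x.
Proof. by apply/ffunP=> u; rewrite ffunE; case: eqP => // ->. Qed.

Lemma agree_upd A x v b : v \notin A -> agree A (upd x v b) x.
Proof.
by move=> vA; apply/agreeP=> u uA; rewrite ffunE; case: eqP uA vA => // -> ->.
Qed.

Definition mix A x y : state V := [ffun v => if v \in A then x v else y v].

Lemma mix_in A x y : agree A (mix A x y) x.
Proof. by apply/agreeP=> v vA; rewrite ffunE vA. Qed.

Lemma mix_out A B x y : [disjoint B & A] -> agree B (mix A x y) y.
Proof.
move=> dis; apply/agreeP=> v vB; rewrite ffunE.
by rewrite (disjointFr dis vB).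
Qed.

End States.

(** * Sums over subsets *)

Section SubsetSums.
Variables (V : finType) (R : realType).
Implicit Types (A B C : {set V}).

Lemma sum_subset_setU A B (F : {set V} -> R) : [disjoint A & B] ->
  \sum_(C : {set V} | C \subset A :|: B) F C =
  \sum_(C1 : {set V} | C1 \subset A) \sum_(C2 : {set V} | C2 \subset B) F (C1 :|: C2).
Proof.
move=> dis; rewrite pair_big_dep /=.
rewrite (reindex_onto (fun c : {set V} * {set V} => c.1 :|: c.2)
                      (fun C => (C :&: A, C :&: B))) /=; last first.
  by move=> C sC; rewrite -setIUr; apply/setIidPl.
apply: eq_bigl => -[C1 C2] /=; apply/andP/andP=> [[_ /eqP[<- <-]]|[s1 s2]].
  by rewrite !subsetIr.
split; first exact: setUSS.
apply/eqP; congr (_, _); rewrite setIUl.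
  rewrite (setIidPl s1) (disjoint_setI0 _) ?setU0 //.
  by rewrite disjoint_sym; apply: disjointWr dis.
rewrite (setIidPl s2) (disjoint_setI0 _) ?set0U //.
exact: disjointWl dis.
Qed.

Lemma sum_subset_set1 v (F : {set V} -> R) :
  \sum_(C : {set V} | C \subset [set v]) F C = F set0 + F [set v].
Proof.
rewrite (bigD1 set0) ?sub0set //= (big_pred1 [set v]) // => C.
rewrite subset1; case: (eqVneq C set0) => [->|_]; last by rewrite orbF andbT.
by rewrite andbF; apply/esym/eqP=> /setP/(_ v); rewrite !inE eqxx.
Qed.

End SubsetSums.

(** * The signed expansion *)

Section Expansion.
Variables (R : realType) (V : finType) (G : admg V) (q : params R G).
Arguments q : clear implicits.
Implicit Types (u v w : V) (A B C D W : {set V}) (H K : Defs.head G).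
Implicit Types (x y z : state V).

Definition head_prod x C :=
  \prod_(H in hpart G C) q H (restrict (tail G (val H)) x).

(** With i standing for v in C, a vertex of value 0 must belong to C, and a vertex
    of value 1 contributes the difference between leaving v out of C and putting
    it in, as in P(X_v = 1) = 1 - P(X_v = 0). *)
Definition wt1 (b i : bool) : R := if i then (-1) ^+ b else b%:R.
Definition wt x W C : R := \prod_(v in W) wt1 (x v) (v \in C).
Definition expansion x W :=
  \sum_(C : {set V} | C \subset W) wt x W C * head_prod x C.

Lemma prob_ofE x : prob_of q x = expansion x setT.
Proof.
rewrite /prob_of /expansion big_mkcond [RHS]big_mkcond.
apply: eq_bigr => C _; rewrite subsetT.
have wtE : wt x setT C = \prod_v wt1 (x v) (v \in C).
  by apply: eq_bigl => v; rewrite inE.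
case: (boolP (zeros x \subset C)) => [/subsetP s|].
  congr (_ * _); rewrite -prodr_const wtE big_mkcond; apply: eq_bigr => v _.
  rewrite !inE /wt1 negbK; case: (boolP (v \in C)) => vC.
    by rewrite andbT; case: (x v).
  rewrite andbF; case: (boolP (x v)) => // xv.
  by case/negP: vC; apply: s; rewrite inE.
case/subsetPn=> v; rewrite inE => /negPf xv vC.
by rewrite wtE (bigD1 v) //= /wt1 (negPf vC) xv !mul0r.
Qed.

Lemma head_prod0 x : head_prod x set0 = 1.
Proof. by rewrite /head_prod hpart0 big_set0. Qed.

Lemma head_prod_remove x C H : H \in Phi G C ->
  head_prod x C = q H (restrict (tail G (val H)) x) * head_prod x (C :\: val H).
Proof. by case/hpart_remove=> e ne; rewrite /head_prod e big_setU1. Qed.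

(** The partition into heads never mixes A and B. *)
Definition splits A B :=
  [disjoint A & B] /\
  forall H, val H \subset A :|: B -> val H \subset A \/ val H \subset B.

Lemma splitsC A B : splits A B -> splits B A.
Proof.
by move=> [dis s]; split=> [|H]; rewrite 1?disjoint_sym // setUC => /s[]; auto.
Qed.

Lemma splitsS A B A' B' : A' \subset A -> B' \subset B -> splits A B -> splits A' B'.
Proof.
move=> sA sB [dis s]; split; first exact: disjointW dis.
move=> H HU; have [HA|HB] := s H (subset_trans HU (setUSS sA sB)).
  left; apply/subsetP=> v vH; have /setUP[//|vB] := subsetP HU _ vH.
  have := disjointFr dis (subsetP HA _ vH).
  by rewrite (subsetP sB _ vB).
right; apply/subsetP=> v vH; have /setUP[vA|//] := subsetP HU _ vH.
have := disjointFl dis (subsetP HB _ vH).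
by rewrite (subsetP sA _ vA).
Qed.

(** A maximal head of A :|: B lies in A, say, and is maximal there too, so it can
    be removed from both sides. *)
Lemma head_prodU x A B : splits A B ->
  head_prod x (A :|: B) = head_prod x A * head_prod x B.
Proof.
elim/ltn_ind: #|A :|: B| {-2}A {-2}B (erefl #|A :|: B|) => n IHn {}A {}B cardAB s.
have [e|W0] := eqVneq (A :|: B) set0.
  move/eqP: (e); rewrite setU_eq0 => /andP[/eqP-> /eqP->].
  by rewrite setU0 head_prod0 mulr1.
have [H HW] := Phi_neq0 G W0.
wlog HA : A B cardAB s {W0} HW / val H \subset A => [wl|].
  have /PhiP[HAB _] := HW; have [HA|HB] := s.2 H HAB; first exact: wl.
  rewrite mulrC setUC; apply: wl HB; rewrite 1?setUC //.
  exact: splitsC.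
rewrite (head_prod_remove x HW).
rewrite (@head_prod_remove x A H); last exact: Phi_sub (subsetUl A B) HA HW.
have dHB : B :\: val H = B.
  by apply/setDidPl; rewrite disjoint_sym; apply: disjointWl s.1.
rewrite setDUl dHB -mulrA; congr (_ * _); apply: (IHn _ _ _ _ erefl).
  rewrite -cardAB; apply: proper_card; apply/properP; split.
    by apply: setUSS; rewrite ?subsetDl.
  have [h hH] := set0Pn _ (head_neq0 H); have hA := subsetP HA _ hH.
  by exists h; rewrite !inE ?hA // hH /= (disjointFr s.1 hA).
by apply: splitsS s; rewrite ?subsetDl.
Qed.

Lemma wtU x A B C1 C2 : [disjoint A & B] -> C1 \subset A -> C2 \subset B ->
  wt x (A :|: B) (C1 :|: C2) = wt x A C1 * wt x B C2.
Proof.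
move=> dis s1 s2; rewrite /wt (eq_bigl [in [predU A & B]]) => [|v]; last first.
  by rewrite !inE.
rewrite bigU //=; congr (_ * _); apply: eq_bigr => v vS.
  rewrite inE; case: (boolP (v \in C2)) => [/(subsetP s2)|]; last by rewrite orbF.
  by rewrite (disjointFr dis vS).
rewrite inE; case: (boolP (v \in C1)) => [/(subsetP s1)|//].
by rewrite (disjointFl dis vS).
Qed.

Lemma expansionU x A B : splits A B ->
  expansion x (A :|: B) = expansion x A * expansion x B.
Proof.
move=> s; rewrite /expansion sum_subset_setU ?s.1 //.
rewrite big_distrlr /=; apply: eq_bigr => C1 s1; apply: eq_bigr => C2 s2.
rewrite wtU ?s.1 // head_prodU; last exact: splitsS s.
by rewrite mulrACA.
Qed.

Lemma expansion0 x : expansion x set0 = 1.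
Proof.
rewrite /expansion (big_pred1 set0) => [|C]; last by rewrite subset0.
by rewrite /wt big_set0 head_prod0 mulr1.
Qed.

Lemma head_prod_agree x y C :
  (forall H, val H \subset C -> agree (tail G (val H)) x y) ->
  head_prod x C = head_prod y C.
Proof.
by move=> e; apply: eq_bigr => H /hpart_sub /e /agree_restrict->.
Qed.

(** Tails of heads inside D lie in D and its parents. *)
Lemma expansion_agree x y A D :
  ancestral G A -> bi_closed G A D -> agree (D :|: paS G D) x y ->
  expansion x D = expansion y D.
Proof.
move=> ancA clD e; apply: eq_bigr => C sC; congr (_ * _).
  apply: eq_bigr => v vD; congr (wt1 _ _); apply: (agreeP _ _ _ e).
  by rewrite inE vD.
apply: head_prod_agree => H sH; apply: agree_sub e.
by apply: (tail_sub ancA clD); apply: subset_trans sH sC.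
Qed.

(** Since v is in no tail, flipping x_v changes only the weight of v; the weights of
    the two values add up to 0 if v is in C and to 1 otherwise. *)
Lemma expansion_marg x A v :
  ancestral G A -> v \in A -> childless G A v ->
  expansion (upd x v false) A + expansion (upd x v true) A
  = expansion x (A :\ v).
Proof.
move=> ancA vA chv; have dis : [disjoint [set v] & A :\ v].
  by rewrite disjoints1 !inE eqxx.
have hpE b C : C \subset A -> head_prod (upd x v b) C = head_prod x C.
  move=> sC; apply: head_prod_agree => H sH; apply: agree_upd.
  exact: childless_tail ancA (subset_trans sH sC) chv.
have expE b : expansion (upd x v b) A =
    \sum_(C : {set V} | C \subset A :\ v) wt x (A :\ v) C *
       (wt1 b false * head_prod x C + wt1 b true * head_prod x (v |: C)).
  rewrite /expansion -{1}(setD1K vA) sum_subset_setU // sum_subset_set1.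
  rewrite -big_split; apply: eq_bigr => C sC /=.
  have sCA : C \subset A := subset_trans sC (subsetDl _ _).
  have vC : v \notin C by apply/negP=> /(subsetP sC); rewrite !inE eqxx.
  have wtE C' : C' \subset [set v] ->
      wt (upd x v b) A (C' :|: C) = wt1 b (v \in C') * wt x (A :\ v) C.
    move=> sC'; rewrite -{1}(setD1K vA) wtU //; congr (_ * _).
      by rewrite /wt big_set1 updE.
    by apply: eq_bigr => u; rewrite !inE ffunE => /andP[/negPf->].
  rewrite !wtE ?sub0set // !set0U !inE eqxx !hpE //; last first.
    by rewrite subUset sub1set vA.
  by rewrite mulrDr; congr (_ + _); rewrite -mulrA mulrCA.
rewrite !expE -big_split; apply: eq_bigr => C _ /=.
by rewrite -mulrDr /wt1 /= mul0r add0r !mul1r mulN1r addrCA subrr addr0.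
Qed.

(** As x vanishes on H, only the sets C containing H have a nonzero weight, and H
    is a maximal head of each of them. *)
Lemma expansion_head x H :
  (forall h, h \in val H -> ~~ x h) ->
  expansion x (anS G (val H)) =
  q H (restrict (tail G (val H)) x) * expansion x (anS G (val H) :\: val H).
Proof.
set A := anS G (val H) => xH; have sHA : val H \subset A by apply: sub_anS.
have dis : [disjoint val H & A :\: val H].
  by rewrite disjoint_sym disjoints_subset subsetDr.
have eA : A = val H :|: (A :\: val H).
  by rewrite -{1}(setID A (val H)) (setIidPr sHA).
rewrite /expansion {1}eA sum_subset_setU // (bigD1 (val H)) //=.
rewrite [X in _ + X]big1 ?addr0 => [|C1 /andP[s1 ne]].
  rewrite big_distrr /=; apply: eq_bigr => C sC.
  rewrite {1}eA wtU // (@head_prod_remove _ _ H); last first.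
    by apply: Phi_anS; rewrite ?subsetUl // subUset sHA (subset_trans sC) ?subsetDl.
  have -> : (val H :|: C) :\: val H = C.
    rewrite setDUl setDv set0U; apply/setDidPl; rewrite disjoint_sym.
    exact: disjointWr dis.
  have -> : wt x (val H) (val H) = 1.
    by apply: big1 => h hH; rewrite hH (negPf (xH _ hH)).
  by rewrite mul1r mulrCA.
have [h hH hC] : exists2 h, h \in val H & h \notin C1.
  by apply/subsetPn; apply: contra ne => s; rewrite eqEsubset s1.
apply: big1 => C sC; rewrite eA wtU // {1}/wt (bigD1 h) //=.
by rewrite (negPf hC) (negPf (xH _ hH)) /wt1 /= !mul0r.
Qed.

End Expansion.

(** * From unblocked walks to unblocked paths *)

Section Walks.
Variables (V : finType) (G : admg V).
Implicit Types (u v w : V) (A B C D : {set V}) (k : edge_kind).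
Implicit Types (s t : seq (edge_kind * V)).

Definition blocked_at C k v k' :=
  if arrow_at_target k && arrow_at_source k' then v \notin anS G C else v \in C.

Lemma blocked_cons C k v k' w s :
  blocked G C ((k, v) :: (k', w) :: s) =
  blocked_at C k v k' || blocked G C ((k', w) :: s).
Proof. by []. Qed.

Lemma blocked_cat C s k v t :
  blocked G C (s ++ (k, v) :: t) =
  blocked G C (rcons s (k, v)) || blocked G C ((k, v) :: t).
Proof.
elim: s => [|[k1 v1] s IHs]; first by [].
rewrite cat_cons rcons_cons; case: s IHs => [_|[k2 v2] s IHs].
  by rewrite cat0s /= orbF.
by rewrite cat_cons rcons_cons !blocked_cons -orbA -rcons_cons -IHs.
Qed.

Lemma walk_cat v s t :
  walk G v (s ++ t) = walk G v s && walk G (endpoint v s) t.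
Proof. by elim: s v => [|[k w] s IHs] v //=; rewrite IHs andbA. Qed.

Lemma endpoint_cat v s t : endpoint v (s ++ t) = endpoint (endpoint v s) t.
Proof. by rewrite /endpoint /unzip2 map_cat last_cat. Qed.

Lemma sub_anSC C v : v \in C -> v \in anS G C.
Proof. exact: (subsetP (sub_anS _ _)). Qed.

(** The walk leaves u along an arrow and ends against one, so following the arrows
    from u leads to a collider; an unblocked collider is an ancestor of C. *)
Lemma forward_backward_collider C s u v :
  walk G u (rcons s (Backward, v)) ->
  ~~ blocked G C ((Forward, u) :: rcons s (Backward, v)) -> u \in anS G C.
Proof.
elim: s u => [|[k w] s IHs] u; rewrite ?rcons_cons.
  by rewrite blocked_cons negb_or /blocked_at /= negbK => _ /andP[].
rewrite blocked_cons negb_or => /andP[uw ws] /andP[].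
case: k uw => /= uw; rewrite /blocked_at /= ?negbK // => _ nb.
exact: (@ancestral_anS _ G C) uw (IHs _ ws nb).
Qed.

(** If v becomes a non-collider by the splice, it was one at its first or at its
    last visit.  If it becomes a collider, either it was one at some visit, or the
    loop starts and ends with edges out of v and so contains a collider that
    descends from v. *)
Lemma splice_walk C a s1 k1 v s2 k2 s3 :
  walk G a (s1 ++ (k1, v) :: s2 ++ (k2, v) :: s3) ->
  ~~ blocked G C (s1 ++ (k1, v) :: s2 ++ (k2, v) :: s3) ->
  walk G a (s1 ++ (k1, v) :: s3) /\ ~~ blocked G C (s1 ++ (k1, v) :: s3).
Proof.
move=> wk nb; move: wk; rewrite !walk_cat /= walk_cat /=.
case/and3P=> -> -> /and3P[ws2 vk2 ->]; split=> //.
move: nb; rewrite blocked_cat negb_or => /andP[nb1 nb2].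
rewrite blocked_cat negb_or nb1 /=.
have := nb2; rewrite -cat_cons blocked_cat negb_or => /andP[nbl].
case: s3 {nb2} => [//|[k4 w] s3].
rewrite !blocked_cons !negb_or => /andP[nc24 ->]; rewrite andbT.
have wl : walk G v (rcons s2 (k2, v)) by rewrite -cats1 walk_cat ws2 /= vk2.
move: nbl; rewrite rcons_cons.
(* If v is not an ancestor of C, only a newly created collider could block. *)
case: (boolP (v \in anS G C)) => [vC|vC]; last first.
  have vC' : v \notin C by apply: contra vC; apply: sub_anSC.
  rewrite /blocked_at; case: ifP => // /andP[t1 s4] nbl.
  move: nc24; rewrite /blocked_at s4 andbT.
  case: k2 vk2 wl nbl => vk2 wl nbl; rewrite /= ?vC //= => _.
  case: s2 {ws2} wl nbl vk2 => [|[k3 u] s2].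
    by rewrite /= t1 vC.
  rewrite !rcons_cons blocked_cons negb_or /blocked_at t1 /=.
  case/andP=> vu ws2 /andP[nc nb] _; case: k3 vu nc nb => //= vu; rewrite ?vC //.
  move=> _ nb; case/negP: vC; apply: (@ancestral_anS _ G C) vu _.
  exact: forward_backward_collider ws2 nb.
case: s2 {ws2 wl vk2} => [|[k3 u] s2].
  rewrite /= orbF; move: nc24; rewrite /blocked_at vC /=.
  by case: k1 {nb1}; case: k4 => //=; case: k2 => //=.
rewrite rcons_cons blocked_cons negb_or => /andP[nc13 _].
move: nc13 nc24; rewrite /blocked_at vC /=.
by case: k1 {nb1}; case: k4 => //=; case: k2 => //=; case: k3.
Qed.

Lemma mem_unzip2_split s v :
  v \in unzip2 s -> exists s1 k s2, s = s1 ++ (k, v) :: s2.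
Proof.
elim: s => [//|[k w] s IHs] /=; rewrite inE => /orP[/eqP->|/IHs].
  by exists [::], k, s.
by case=> s1 [k' [s2 ->]]; exists ((k, w) :: s1), k', s2.
Qed.

Lemma not_uniq_split s : ~~ uniq (unzip2 s) ->
  exists s1 k1 v s2 k2 s3, s = s1 ++ (k1, v) :: s2 ++ (k2, v) :: s3.
Proof.
elim: s => [//|[k w] s IHs] /=; rewrite negb_and negbK => /orP[|/IHs].
  by move=> /mem_unzip2_split[s2 [k2 [s3 ->]]]; exists [::], k, w, s2, k2, s3.
case=> s1 [k1 [v [s2 [k2 [s3 ->]]]]].
by exists ((k, w) :: s1), k1, v, s2, k2, s3.
Qed.

Lemma msep_walk A B C a b s :
  msep G A B C -> a \in A -> b \in B ->
  walk G a s -> endpoint a s = b -> blocked G C s.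
Proof.
move=> sep aA bB; elim/ltn_ind: (size s) {-2}s (erefl (size s)) => n IHn {}s sz ws es.
have [us|] := boolP (uniq (a :: unzip2 s)).
  by apply: sep aA bB _ es; rewrite /is_path ws.
move=> nu; apply: contraT => nb; move: nu; rewrite /= negb_and negbK => /orP[].
  (* The walk returns to its starting point: drop everything before. *)
  case/mem_unzip2_split=> s1 [k [s2 e]]; subst s.
  move: ws nb es; rewrite walk_cat endpoint_cat blocked_cat negb_or /=.
  case/and3P=> _ _ ws2 /andP[_ nb2] es.
  have sz2 : (size s2 < n)%N by rewrite -sz size_cat /= addnS ltnS leq_addl.
  have := IHn _ sz2 s2 erefl ws2 es.
  by case: s2 nb2 {sz ws2 es sz2} => //= -[k2 w] s2 /norP[_ /negPf->].
case/not_uniq_split=> s1 [k1 [v [s2 [k2 [s3 e]]]]]; subst s.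
have [ws' nb'] := splice_walk ws nb; case/negP: nb'.
apply: IHn erefl ws' _.
  by rewrite -sz !size_cat /= size_cat /= ltn_add2l ltnS addnS ltnS leq_addl.
by rewrite -es /endpoint /unzip2 !map_cat !last_cat /= map_cat last_cat.
Qed.

End Walks.

(** * Vertices reached by unblocked walks *)

Section OpenWalks.
Variables (V : finType) (G : admg V) (A B C : {set V}).
Implicit Types (u v w : V) (k : edge_kind).

(** [reach k w]: some unblocked walk starts in A and ends with an edge of kind k
    leading to w. *)
Inductive reach : edge_kind -> V -> Prop :=
| reach_start a k w : a \in A -> joins G k a w -> reach k w
| reach_step k v k' w :
    reach k v -> joins G k' v w -> ~~ blocked_at G C k v k' -> reach k' w.

Lemma reach_walk k w : reach k w -> exists a s,
  [/\ a \in A, walk G a (rcons s (k, w)) & ~~ blocked G C (rcons s (k, w))].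
Proof.
elim=> {k w} [a k w aA aw|k v k' w _ [a [s [aA ws nb]]] vw nc].
  by exists a, [::]; rewrite /= aw.
exists a, (rcons s (k, v)); split=> //.
  by rewrite -cats1 walk_cat ws -cats1 endpoint_cat /= vw.
by rewrite -cats1 cat_rcons blocked_cat negb_or nb blocked_cons negb_or nc.
Qed.

Hypothesis sep : msep G A B C.

Lemma reach_notin k b : reach k b -> b \notin B.
Proof.
case/reach_walk=> a [s [aA ws nb]]; apply: contra nb => bB.
by apply: (msep_walk sep aA bB ws); rewrite -cats1 endpoint_cat.
Qed.

(** The directed path from v to a, walked backwards, has no colliders, and avoids C
    since v is not an ancestor of C. *)
Lemma reach_back a v : a \in A -> connect (dir G) v a -> v \notin anS G C ->
  v \in A \/ reach Backward v.
Proof.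
move=> aA /connectP[s sp ea]; rewrite {}ea in aA.
elim: s v sp aA => [|u s IHs] v /=; first by left.
case/andP=> vu us aA vC.
have uC : u \notin anS G C by apply: contra vC; apply: (@ancestral_anS _ G C).
right; have [uA|ru] := IHs _ us aA uC; first exact: (@reach_start u Backward v).
by apply: (@reach_step _ _ Backward v ru) => //; apply: contra uC; apply: sub_anSC.
Qed.

(** Otherwise the walk could be prolonged along the directed path to b, without
    being blocked, against the m-separation of A and B. *)
Lemma reach_forward b k v : b \in B -> connect (dir G) v b ->
  v \notin anS G C -> ~ reach k v.
Proof.
move=> bB /connectP[s sp eb]; rewrite {}eb in bB.
elim: s v k sp bB => [|u s IHs] v k /=.
  by move=> _ bB _ /reach_notin; rewrite bB.
case/andP=> vu us bB vC rv.
have uC : u \notin anS G C by apply: contra vC; apply: (@ancestral_anS _ G C).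
apply: (IHs u Forward us bB uC); apply: (@reach_step _ _ Forward u rv) => //.
by rewrite /blocked_at /= andbF; apply: contra vC; apply: sub_anSC.
Qed.

Let M := anS G (A :|: B :|: C).

(** Within M the walk passes a collider v even if v is not an ancestor of C: if v
    is an ancestor of A, the walk may be restarted from A along [reach_back]; and
    v cannot be an ancestor of B, by [reach_forward]. *)
Lemma reach_extend k v k' w :
  reach k v -> joins G k' v w -> v \in M ->
  (v \in C -> arrow_at_target k && arrow_at_source k') -> reach k' w.
Proof.
move=> rv vw vM vC.
have [co|nco] := boolP (arrow_at_target k && arrow_at_source k'); last first.
  apply: reach_step rv vw _; rewrite /blocked_at (negPf nco).
  by apply/negP=> /vC; rewrite (negPf nco).
have [aC|naC] := boolP (v \in anS G C).
  by apply: reach_step rv vw _; rewrite /blocked_at co aC.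
have /anSP[t] := vM; rewrite !inE -orbA => /or3P[tA|tB|tC] vt.
- have [vA|rv'] := reach_back tA vt naC; first exact: reach_start vA vw.
  by apply: reach_step rv' vw _; apply: contra naC; apply: sub_anSC.
- by case: (reach_forward tB vt naC rv).
- by case/negP: naC; apply/anSP; exists t.
Qed.

Definition reachable : {set V} :=
  [set s in M :\: C | (s \in A) || `[< exists k, reach k s >]].

Lemma reachable_sub : reachable \subset M :\: C.
Proof. by apply/subsetP=> s; rewrite inE => /andP[]. Qed.

Lemma reach_reachable k w : reach k w -> w \in M -> w \notin C -> w \in reachable.
Proof.
move=> rw wM wC; rewrite !inE wM wC /=; apply/orP; right.
by apply/asboolP; exists k.
Qed.

Lemma reachable_step s k w : s \in reachable -> joins G k s w -> reach k w.
Proof.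
rewrite inE in_setD => /andP[/andP[sC sM] /orP[sA|/asboolP[k' rs]]] sw.
  exact: reach_start sA sw.
by apply: reach_extend rs sw sM _; rewrite (negPf sC).
Qed.

Lemma sub_reachable : [disjoint A & C] -> A \subset reachable.
Proof.
move=> dis; apply/subsetP=> a aA; rewrite !inE aA (disjointFr dis aA) /= andbT.
by apply/anSP; exists a; rewrite ?connect0 // !inE aA.
Qed.

Lemma reachable_disjoint : [disjoint A & B] -> [disjoint B & reachable].
Proof.
move=> dis; rewrite disjoint_sym disjoints_subset; apply/subsetP=> s.
rewrite !inE => /andP[_ /orP[sA|/asboolP[k /reach_notin//]]].
by rewrite (disjointFr dis sA).
Qed.

(** The union of the districts of M that contain a reachable vertex or a child of
    one. *)
Definition touched : {set V} :=
  [set d in M | [exists d', (connect (bi_in G M) d' d && (d' \in M)) &&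
     ((d' \in reachable) || [exists s in reachable, dir G s d'])]].

Lemma touched_closed : bi_closed G M touched.
Proof.
split; first by apply/subsetP=> d; rewrite inE => /andP[].
move=> v w; rewrite !inE => /andP[vM /existsP[d /andP[/andP[dv dM] t]]] wM vw.
rewrite wM; apply/existsP; exists d; rewrite t dM !andbT.
by apply: connect_trans dv (connect1 _); rewrite /bi_in /= vM wM.
Qed.

(** All vertices strictly inside a bidirected path are colliders, so the whole
    district can be walked through, even at vertices of C. *)
Lemma touched_reach d : d \in touched ->
  d \in reachable \/ exists2 k, reach k d & arrow_at_target k.
Proof.
rewrite inE => /andP[_ /existsP[d' /andP[/andP[/connectP[t pt ->] d'M] d'S]]].
have {d'S} : d' \in reachable \/ exists2 k, reach k d' & arrow_at_target k.
  case/orP: d'S => [|/exists_inP[s sS sd]]; first by left.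
  by right; exists Forward => //; exact: (@reachable_step s Forward).
elim: t d' pt d'M => [//|e t IHt] d' /= /andP[/and3P[d'M eM d'e] et] _ d'S.
apply: IHt et eM _; right; exists Bidirected => //.
case: d'S => [d'S|[k rk ak]]; first exact: (@reachable_step d' Bidirected).
by apply: (@reach_extend _ _ Bidirected _ rk d'e d'M); rewrite ak.
Qed.

Lemma touched_sub : touched :|: paS G touched \subset reachable :|: C.
Proof.
apply/subsetP=> w wT; rewrite inE orbC; have [//|wC /=] := boolP (w \in C).
have [/subsetP tM _] := touched_closed.
case/setUP: wT => [wT|/bigcupP[d dT]].
  by have [//|[k rk _]] := touched_reach wT; apply: reach_reachable rk (tM _ wT) wC.
rewrite inE => wd.
have rw : reach Backward w.
  have [dS|[k rk ak]] := touched_reach dT; first exact: (@reachable_step d Backward).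
  by apply: (@reach_extend _ _ Backward _ rk wd (tM _ dT)); rewrite ak.
apply: reach_reachable rw _ wC; exact: (@ancestral_anS _ G _) wd (tM _ dT).
Qed.

Lemma untouched_closed : bi_closed G M (M :\: touched).
Proof.
have [tM tc] := touched_closed; split; first exact: subsetDl.
move=> v w /setDP[vM vT] wM vw; rewrite inE wM andbT; apply: contra vT => wT.
by apply: tc wT vM _; rewrite bi_sym.
Qed.

Lemma untouched_sub :
  (M :\: touched) :|: paS G (M :\: touched) \subset M :\: reachable.
Proof.
apply/subsetP=> w /setUP[/setDP[wM wT]|/bigcupP[d /setDP[dM dT]]].
  rewrite inE wM andbT; apply: contra wT => wS; rewrite inE wM.
  by apply/existsP; exists w; rewrite connect0 wM wS.
rewrite inE => wd; rewrite inE (@ancestral_anS _ G _ _ _ wd dM) andbT.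
apply: contra dT => wS; rewrite inE dM; apply/existsP; exists d.
by rewrite connect0 dM /=; apply/orP; right; apply/exists_inP; exists w.
Qed.

End OpenWalks.

(** * Margins of a distribution *)

Section Marginals.
Variables (R : realType) (V : finType).
Implicit Types (v : V) (A B C S M E : {set V}) (x y z : state V) (p : state V -> R).

Definition marg p A x : R := \sum_(y | agree A y x) p y.

Lemma marg_gt0 p A x : (forall y, 0 < p y) -> 0 < marg p A x.
Proof.
move=> p0; rewrite /marg (bigD1 x) ?agree_refl //=.
by apply: ltr_pwDl => //; apply: sumr_ge0 => y _; apply: ltW.
Qed.

Lemma margT p x : marg p setT x = p x.
Proof. by apply: big_pred1 => y; rewrite agreeT. Qed.

Lemma marg0 p x : marg p set0 x = \sum_y p y.
Proof. by apply: eq_bigl => y; apply/agreeP=> v; rewrite inE. Qed.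

Lemma margD1 p A v x : v \in A ->
  marg p A (upd x v false) + marg p A (upd x v true) = marg p (A :\ v) x.
Proof.
move=> vA; rewrite [RHS](bigID (fun y => ~~ y v)) /=.
have E b : marg p A (upd x v b) = \sum_(y | agree (A :\ v) y x && (y v == b)) p y.
  apply: eq_bigl => y; rewrite -{1}(setD1K vA) agreeU andbC; congr (_ && _).
    have := agree_upd x b (negbT (setD11 v A)) => e.
    apply/idP/idP=> ye; apply: agree_trans ye _ => //; by rewrite agree_sym.
  by apply/agreeP/eqP=> [/(_ v (set11 v))|e u /set1P->]; rewrite updE.
by rewrite !E; congr (_ + _); apply: eq_bigl => y; case: (y v).
Qed.

(** The states of M extending x on E are represented by full states that agree with
    x outside M. *)
Lemma marg_marg p E M x : E \subset M ->
  marg p E x = \sum_(y | agree (E :|: ~: M) y x) marg p M y.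
Proof.
move=> sEM; rewrite /marg.
rewrite (partition_big (fun z => mix M z x) (fun y => agree (E :|: ~: M) y x)) /=.
  apply: eq_bigr => y; rewrite agreeU => /andP[yE yM]; apply: eq_bigl => z.
  apply/andP/idP=> [[_ /eqP<-]|zy].
    by rewrite agree_sym; apply: mix_in.
  split; first exact: agree_trans (agree_sub sEM zy) yE.
  apply/eqP/ffunP=> v; rewrite ffunE; case: ifP => vM; first exact: (agreeP _ _ _ zy).
  by rewrite (agreeP _ _ _ yM) // inE vM.
move=> z zE; rewrite agreeU (@mix_out _ M (~: M)) ?andbT.
  exact: agree_trans (agree_sub sEM (mix_in _ _ _)) zE.
by rewrite disjoint_sym disjoints_subset setCK.
Qed.

Lemma prob_event p A x : prob p (event (restrict A x)) = marg p A x.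
Proof. by apply: eq_bigl => y; rewrite inE restrict_agree. Qed.

Lemma event_setI A B x :
  event (restrict A x) :&: event (restrict B x) = event (restrict (A :|: B) x).
Proof. by apply/setP=> y; rewrite !inE !restrict_agree agreeU. Qed.

Lemma cond_indep_margE p A B C : (forall x, 0 < p x) ->
  cond_indep p A B C <->
  forall x, marg p (A :|: B :|: C) x * marg p C x
            = marg p (A :|: C) x * marg p (B :|: C) x.
Proof.
move=> p0.
suff E x : (let EA := event (restrict A x) in
    let EB := event (restrict B x) in
    let EC := event (restrict C x) in
    cond_prob p (EA :&: EB) EC = cond_prob p EA EC * cond_prob p EB EC) <->
    marg p (A :|: B :|: C) x * marg p C x = marg p (A :|: C) x * marg p (B :|: C) x.
  by split=> H x; apply/E; apply: H.
rewrite /cond_prob /= !event_setI !prob_event.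
have C0 : marg p C x != 0 by rewrite gt_eqF ?marg_gt0.
rewrite mulrACA -invfM; split=> [/eqP|e].
  rewrite eqr_div ?mulf_neq0 // mulrA => /eqP/(mulIf C0).
  by [].
by apply/eqP; rewrite eqr_div ?mulf_neq0 // mulrA e.
Qed.

(** Both sides are sums over pairs of states of a product of two margins over M.
    Exchanging the coordinates in S between the two states maps the index set of
    one side onto that of the other.  As the states agree on C, it keeps the two
    values of g and exchanges those of h, so it preserves the summand. *)
Lemma factor_indep p A B C S M (g h : state V -> R) :
  A \subset S -> S \subset M -> B \subset M -> C \subset M ->
  [disjoint B & S] -> [disjoint C & S] ->
  (forall y, marg p M y = g y * h y) ->
  (forall y z, agree (S :|: C) y z -> g y = g z) ->
  (forall y z, agree (M :\: S) y z -> h y = h z) ->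
  forall x, marg p (A :|: B :|: C) x * marg p C x
            = marg p (A :|: C) x * marg p (B :|: C) x.
Proof.
move=> sAS sSM sBM sCM dBS dCS pE gE hE x.
have sAM := subset_trans sAS sSM.
rewrite !(@marg_marg p _ M) ?subUset ?sAM ?sBM ?sCM //.
rewrite !big_distrlr !pair_big /=.
pose swap (c : state V * state V) := (mix S c.1 c.2, mix S c.2 c.1).
have swapK : involutive swap.
  move=> [y z]; rewrite /swap /=; congr (_, _); apply/ffunP=> v; rewrite !ffunE;
  by case: (v \in S).
rewrite (reindex_inj (inv_inj swapK)) /=; apply: eq_big => [[y z]|[y z]] /=.
  rewrite !agreeU.
  have dMS : [disjoint ~: M & S] by rewrite disjoint_sym disjoints_subset setCK.
  have sub (D : {set V}) (a b : state V) : D \subset S ->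
      agree D (mix S a b) x = agree D a x.
    move=> sD; have e := agree_sub sD (mix_in S a b).
    apply/idP/idP; apply: agree_trans => //; by rewrite agree_sym.
  have out (D : {set V}) (a b : state V) : [disjoint D & S] ->
      agree D (mix S a b) x = agree D b x.
    move=> sD; have e := mix_out a b sD.
    apply/idP/idP; apply: agree_trans => //; by rewrite agree_sym.
  rewrite !(sub A) // !(out B) // !(out C) // !(out (~: M)) //.
  by case: (agree A y x); case: (agree B z x); case: (agree C y x);
     case: (agree C z x); case: (agree (~: M) y x); case: (agree (~: M) z x).
rewrite !agreeU => /andP[/andP[/andP[_ cy] _] /andP[cz _]].
rewrite /swap /= !pE.
have gm a b : agree C (mix S a b) x -> agree C (mix S b a) x -> g (mix S a b) = g a.
  move=> ca cb; apply: gE; rewrite agreeU mix_in /=.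
  apply: agree_trans (mix_out b a dCS).
  by apply: agree_trans ca _; rewrite agree_sym.
have hm a b : h (mix S a b) = h b.
  by apply: hE; apply: mix_out; rewrite disjoint_sym disjoints_subset setCD subsetUr.
by rewrite !gm // !hm mulrACA [h z * h y]mulrC mulrACA.
Qed.

End Marginals.

(** * The local Markov property *)

Section LocalMarkov.
Variables (V : finType) (G : admg V) (A H : {set V}).
Implicit Types (u v w : V) (k : edge_kind).

Hypothesis ancA : ancestral G A.
Hypothesis sHA : H \subset A.
Hypothesis chH : forall h, h \in H -> childless G A h.

Let D := disS G A H.
Let C := (D :|: paS G D) :\: H.
Let B := A :\: (D :|: paS G D).

Lemma blanket_sub : D :|: paS G D \subset A.
Proof.
have [/subsetP sDA _] := disS_closed G A H; rewrite subUset; apply/andP; split.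
  exact/subsetP.
apply/subsetP=> v /bigcupP[d /sDA dA]; rewrite inE => vd; exact: ancA vd dA.
Qed.

(** A walk that leaves A along an arrowhead can come back only through a collider
    outside A, hence not an ancestor of C. *)
Lemma blocked_outside k v s : v \notin A -> arrow_at_target k ->
  walk G v s -> endpoint v s \in A -> blocked G C ((k, v) :: s).
Proof.
elim: s k v => [|[k' w] s IHs] k v vA ak; first by move=> _ /=; rewrite (negPf vA).
rewrite -[endpoint v _]/(endpoint w s) => /andP[vw ws] eA.
rewrite blocked_cons /blocked_at ak; apply/orP.
case: (boolP (arrow_at_source k')) => k's; [left|right].
  apply: contra vA => /(subsetP (anS_min ancA _)); apply.
  exact: subset_trans (subsetDl _ _) blanket_sub.
case: k' vw k's => //= vw _; apply: (IHs Forward w) => //.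
by apply: contra vA => wA; apply: ancA vw wA.
Qed.

(** Inside D every unblocked vertex of C is a collider, so the walk moves within D
    along bidirected edges until it steps to a parent of D, which blocks it, or
    out of A. *)
Lemma blocked_district v s : v \in D -> walk G v s -> endpoint v s \in B ->
  (forall k, arrow_at_target k -> blocked G C ((k, v) :: s)) /\
  (v \in H -> blocked G C s).
Proof.
have [/subsetP sDA clD] := disS_closed G A H; have /subsetP sbl := blanket_sub.
elim: s v => [|[k' w] s IHs] v vD.
  by move=> _; rewrite /endpoint /= inE inE vD.
rewrite -[endpoint v _]/(endpoint w s) => /andP[vw ws] eB.
have eA : endpoint w s \in A by move: eB; rewrite !inE => /andP[].
have mon k : blocked G C ((k', w) :: s) -> blocked G C ((k, v) :: (k', w) :: s).
  by rewrite blocked_cons => ->; rewrite orbT.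
suff [b|[ek vH]] : blocked G C ((k', w) :: s) \/ (k' = Forward /\ v \notin H).
- by split=> [k _|//]; apply: mon.
- split=> [k _|]; last by rewrite (negPf vH).
  by rewrite blocked_cons ek /blocked_at /= andbF !inE vH vD.
case: k' vw {mon} => vw; rewrite /joins in vw; last 1 first.
- left; have [wA|wA] := boolP (w \in A); last exact: blocked_outside.
  by have [b _] := IHs w (clD _ _ vD wA vw) ws eB; apply: b.
- have [vH|] := boolP (v \in H); [left|by right].
  apply: blocked_outside => //; apply/negP=> wA.
  by have := chH vH wA; rewrite vw.
left; have wP : w \in paS G D by apply/bigcupP; exists v; rewrite // inE.
case: s ws eB {IHs eA} => [_|[k2 u] s _ _].
  by rewrite /endpoint /= inE inE wP orbT.
rewrite blocked_cons /blocked_at /= !inE wP orbT andbT; apply/orP; left.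
by apply/negP=> wH; have := chH wH (sDA _ vD); rewrite vw.
Qed.

Lemma local_msep : msep G H B C.
Proof.
move=> a b s aH bB /andP[ws _] es.
have aD : a \in D by apply: (subsetP (sub_disS _ sHA)).
by have [_] := blocked_district aD ws (eq_ind_r (fun v => v \in B) bB es); apply.
Qed.

Lemma local_markov (R : realType) (p : state V -> R) x :
  H != set0 -> in_model G p ->
  marg p A x * marg p C x = marg p (H :|: C) x * marg p (A :\: H) x.
Proof.
move=> H0 [p0 _ gm].
have sHD : H \subset D := sub_disS _ sHA.
have sHbl : H \subset D :|: paS G D := subset_trans sHD (subsetUl _ _).
have eHC : H :|: C = D :|: paS G D.
  by rewrite -(setID (D :|: paS G D) H) (setIidPr sHbl).
have eA : H :|: B :|: C = A.
  rewrite setUAC eHC -[RHS](setID A (D :|: paS G D)); congr (_ :|: _).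
  by apply/esym/setIidPr/blanket_sub.
have dHB : [disjoint H & B].
  by apply: disjointWl sHbl _; rewrite disjoint_sym disjoints_subset subsetDr.
have eAH : B :|: C = A :\: H.
  have -> : A :\: H = (B :\: H) :|: (C :\: H).
    by rewrite -eA -setUA !setDUl setDv set0U.
  rewrite [C :\: H]setDDl setUid; congr (_ :|: _).
  by apply/esym/setDidPl; rewrite disjoint_sym.
(* Independence from no variables is not an instance of the Markov property. *)
have [B0|B0] := eqVneq B set0.
  by rewrite -{1}eA -eAH B0 setU0 set0U.
have /(cond_indep_margE _ _ _ p0)/(_ x) : cond_indep p H B C.
  apply: gm; rewrite ?dHB //; last exact: local_msep.
  - by rewrite disjoint_sym disjoints_subset subsetDr.
  - rewrite disjoints_subset; apply: subset_trans (subsetDr _ _) _.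
    by rewrite setCS subsetDl.
by rewrite eA eAH.
Qed.

End LocalMarkov.

(** * The expansion over an ancestral set *)

Section Common.
Variables (R : realType) (V : finType) (G : admg V).
Implicit Types (v : V) (A B C D W M : {set V}) (H : Defs.head G) (x y : state V).

Lemma closed_splits A D W : ancestral G A -> bi_closed G A D -> W \subset A ->
  [disjoint D & W] -> splits G D W.
Proof.
move=> ancA clD sWA dis; split=> // H HU.
have sHA : val H \subset A by rewrite (subset_trans HU) // subUset sWA clD.1.
have [|HD] := head_side ancA clD (valP H) sHA; first by left.
right; apply/subsetP=> h hH; have /setUP[hD|//] := subsetP HU _ hH.
by have := disjointFr HD hH; rewrite hD.
Qed.

Lemma disjoint_setDr D A : [disjoint D & A :\: D].
Proof. by rewrite disjoint_sym disjoints_subset subsetDr. Qed.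

Lemma expansion_closedD q A D x : ancestral G A -> bi_closed G A D ->
  expansion (q : params R G) x A = expansion q x D * expansion q x (A :\: D).
Proof.
move=> ancA clD; rewrite -expansionU.
  by rewrite -{1}(setID A D) (setIidPr clD.1).
by apply: closed_splits ancA clD (subsetDl _ _) (disjoint_setDr _ _).
Qed.

Lemma expansion_closedD1 q A D v x : ancestral G A -> bi_closed G A D -> v \in D ->
  expansion (q : params R G) x (A :\ v)
  = expansion q x (D :\ v) * expansion q x (A :\: D).
Proof.
move=> ancA clD vD; rewrite -expansionU.
  congr expansion; apply/setP=> u; rewrite !inE; have := subsetP clD.1 u.
  case: eqP => [->|_] /=; first by rewrite vD.
  by case: (u \in D) => // ->.
apply: splitsS (closed_splits ancA clD (subsetDl _ _) (disjoint_setDr _ _)) => //.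
exact: subsetDl.
Qed.

Lemma params_ofE (p : state V -> R) H x : (forall h, h \in val H -> ~~ x h) ->
  params_of p (restrict (tail G (val H)) x)
  = marg p (val H :|: tail G (val H)) x / marg p (tail G (val H)) x.
Proof.
move=> xH; rewrite /params_of /cond_prob prob_event; congr (_ / _).
apply: eq_bigl => y; rewrite !inE restrict_agree agreeU; congr (_ && _).
apply/forall_inP/agreeP=> [yH h hH|e h hH].
  by rewrite (negPf (yH _ hH)) (negPf (xH _ hH)).
by rewrite e ?xH.
Qed.

Lemma tail_sub_anS H : tail G (val H) \subset anS G (val H) :\: val H.
Proof.
rewrite (tailE (valP H)) setSD //; apply: blanket_sub.
exact: ancestral_anS.
Qed.

End Common.

(** * Positive expansions are derived *)

Section Sufficiency.
Variables (R : realType) (V : finType) (G : admg V) (q : params R G).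
Implicit Types (v : V) (A B C D W M : {set V}) (H : Defs.head G) (x y : state V).

(** From V down to A, vertices without children are summed out one at a time. *)
Lemma marg_prob_of A x : ancestral G A -> marg (prob_of q) A x = expansion q x A.
Proof.
elim/ltn_ind: #|~: A| {-2}A (erefl #|~: A|) x => n IHn {}A cA x ancA.
have [->|AT] := eqVneq A setT; first by rewrite margT prob_ofE.
have [v [vA ancvA chv]] := exists_ancestralU1 ancA AT.
have vvA : v \in v |: A by apply: setU11.
rewrite -{1}(setU1K vA) -margD1 //.
have lt : (#|~: (v |: A)| < n)%N.
  by rewrite -cA; apply: proper_card; rewrite properC properUr // sub1set.
rewrite !(IHn _ lt _ erefl) // expansion_marg // setU1K //.
Qed.

Hypothesis pos : forall x, 0 < prob_of q x.

Lemma prob_of_sum1 : \sum_x prob_of q x = 1.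
Proof.
pose x0 : state V := [ffun => false].
rewrite -(marg0 _ x0) marg_prob_of ?expansion0 // => v w _.
by rewrite inE.
Qed.

Lemma prob_of_global_markov : global_markov G (prob_of q).
Proof.
move=> A B C dAB dAC dBC _ _ sep; apply/(cond_indep_margE _ _ _ pos).
pose M := anS G (A :|: B :|: C); pose W := touched G A B C.
have ancM : ancestral G M := @ancestral_anS _ G _.
have sM : A :|: B :|: C \subset M by apply: sub_anS.
have [sAM sBM sCM] : [/\ A \subset M, B \subset M & C \subset M].
  by move: sM; rewrite !subUset => /andP[/andP[]].
have clW : bi_closed G M W := touched_closed G A B C.
have sSMC := reachable_sub G A B C.
apply: (@factor_indep _ _ _ A B C (reachable G A B C) M
  (fun y => expansion q y W) (fun y => expansion q y (M :\: W))) => //.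
- exact: sub_reachable.
- exact: subset_trans sSMC (subsetDl _ _).
- exact: reachable_disjoint.
- by rewrite disjoint_sym; apply: disjointWl sSMC _; rewrite disjoints_subset subsetDr.
- by move=> y; rewrite marg_prob_of // (expansion_closedD _ _ ancM clW).
- move=> y z e; apply: (expansion_agree _ ancM clW); apply: agree_sub e.
  exact: touched_sub.
- move=> y z e; apply: (expansion_agree _ ancM (untouched_closed G A B C)).
  by apply: agree_sub e; apply: untouched_sub.
Qed.

(** On an(H) the margin is q_H(x_T) times the margin over an(H) minus H; summing over
    the coordinates outside H and T leaves the factor q_H(x_T). *)
Lemma prob_of_params H xT : q xT = params_of (prob_of q) (H := H) xT.
Proof.
set T := tail G (val H) in xT *.
(* Extending xT by 0 makes the state vanish on H, which is disjoint from T. *)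
pose x : state V := [ffun v => if insub v is Some u then xT u else false].
have -> : xT = restrict T x.
  by apply/ffunP=> u; rewrite !ffunE valK.
have sT := tail_sub_anS H; set A := anS G (val H) in sT.
have xH h : h \in val H -> ~~ x h.
  move=> hH; rewrite ffunE; case: insubP => // u hT _.
  by have := subsetP sT _ hT; rewrite inE hH.
have sHA : val H \subset A by apply: sub_anS.
have ancA : ancestral G A := @ancestral_anS _ G _.
have ancAH : ancestral G (A :\: val H).
  by apply: ancestralD ancA _ => h; apply: head_childless (valP H).
rewrite params_ofE // -/T.
rewrite (@marg_marg _ _ _ (val H :|: T) A); last first.
  by rewrite subUset sHA (subset_trans sT) ?subsetDl.
rewrite (@marg_marg _ _ _ T (A :\: val H)) //.
have eU : val H :|: T :|: ~: A = T :|: ~: (A :\: val H).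
  by rewrite setCD -setUA setUCA [val H :|: _]setUC.
rewrite eU; set S := \sum_(y | _) marg _ (A :\: _) _.
have S0 : S != 0.
  by rewrite /S -marg_marg // gt_eqF // marg_gt0.
rewrite (eq_bigr (fun y => q (restrict T x) * marg (prob_of q) (A :\: val H) y)).
  by rewrite -big_distrr /= mulfK.
move=> y; rewrite -eU agreeU => /andP[]; rewrite agreeU => /andP[yH yT] _.
rewrite !marg_prob_of // expansion_head; last first.
  by move=> h hH; rewrite (agreeP _ _ _ yH) ?xH.
by rewrite (agree_restrict yT).
Qed.

Lemma derived_prob_of : derived q.
Proof.
exists (prob_of q); last exact: prob_of_params.
split; [exact: pos|exact: prob_of_sum1|exact: prob_of_global_markov].
Qed.

End Sufficiency.

(** * Margins of a distribution in the model *)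

Section Necessity.
Variables (R : realType) (V : finType) (G : admg V) (q : params R G).
Variable p : state V -> R.
Hypothesis pM : in_model G p.
Hypothesis qE : forall (H : Defs.head G) xT, q xT = params_of p (H := H) xT.
Implicit Types (v : V) (A B C D W M : {set V}) (H : Defs.head G) (x y : state V).

Let p_gt0 : forall x, 0 < p x. Proof. by have [] := pM. Qed.
Let marg_neq0 A x : marg p A x != 0. Proof. by rewrite gt_eqF ?marg_gt0. Qed.

(** Vertices of H have no children in an(H), so both sides behave in the same way
    under summation over x_h.  Hence a value 1 on H can be turned into 0, and for
    x vanishing on H both sides are q_H(x_T) times the term for an(H) minus H. *)
Lemma marg_head H x : 
  (forall v, v \in val H -> forall y,
     marg p (anS G (val H) :\ v) y = expansion q y (anS G (val H) :\ v)) ->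
  (forall y, marg p (anS G (val H) :\: val H) y
             = expansion q y (anS G (val H) :\: val H)) ->
  marg p (anS G (val H)) x = expansion q x (anS G (val H)).
Proof.
set A := anS G (val H) => IH1 IHH.
have ancA : ancestral G A := @ancestral_anS _ G _.
have sHA : val H \subset A by apply: sub_anS.
have chH h : h \in val H -> childless G A h by apply: head_childless (valP H).
elim/ltn_ind: #|[set h in val H | x h]| {-2}x (erefl #|[set h in val H | x h]|).
move=> n IHn {}x cx.
(* Both sides have the same sum over x_h, so x_h = 1 reduces to x_h = 0. *)
have [/existsP[h /andP[hH xh]]|] := boolP [exists h, (h \in val H) && x h].
  have hA := subsetP sHA _ hH.
  have := margD1 p x hA; rewrite IH1 // -(expansion_marg _ _ ancA hA (chH _ hH)).
  have ex : upd x h true = x by rewrite -{2}(upd_id x h) xh.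
  rewrite ex (IHn #|[set k in val H | upd x h false k]|) //; first by move/addrI.
  rewrite -cx; apply: proper_card; apply/properP; split.
    apply/subsetP=> k; rewrite !inE ffunE => /andP[->].
    by case: eqP.
  by exists h; rewrite !inE ?updE ?hH ?xh // andbF.
rewrite negb_exists => /forallP xH.
have {}xH h : h \in val H -> ~~ x h by move=> hH; have := xH h; rewrite hH.
rewrite expansion_head // -IHH qE params_ofE //.
have := local_markov ancA sHA chH x (head_neq0 H) pM.
rewrite -(tailE (valP H)) => e.
by apply: (mulIf (marg_neq0 (tail G (val H)) x)); rewrite e mulrAC mulfVK.
Qed.

(** Induction on #|A| through a vertex v without children in A, with district D.
    Either D generates A, which is the case of [marg_head], or the local Markov
    property in A and in an(D) gives the same conditional law of x_v. *)
Lemma marg_expansion A x : ancestral G A -> marg p A x = expansion q x A.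
Proof.
elim/ltn_ind: #|A| {-2}A (erefl #|A|) x => n IHn {}A cA x ancA.
have [->|A0] := eqVneq A set0.
  by rewrite marg0 expansion0; have [] := pM.
have {}IHn W y : ancestral G W -> W \proper A -> marg p W y = expansion q y W.
  by move=> ancW /proper_card; rewrite cA => lt; apply: IHn lt _ erefl _ ancW.
have [v vA chv] := exists_childless G A0.
have sv : [set v] \subset A by rewrite sub1set.
pose D := disS G A [set v]; pose A' := anS G D.
have clD : bi_closed G A D := disS_closed G A [set v].
have vD : v \in D by rewrite -sub1set; apply: sub_disS.
have sA'A : A' \subset A := anS_min ancA clD.1.
have sDA' : D \subset A' := sub_anS G D.
have vA' : v \in A' := subsetP sDA' _ vD.
have ancA' : ancestral G A' := @ancestral_anS _ G _.
have connD u w : u \in D -> w \in D -> connect (bi_in G A') u w.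
  have pathD s z : z \in D -> path (bi_in G A) z s ->
      connect (bi_in G A') z (last z s).
    elim: s z => [//|z' s IHs] z zD /= /andP[/and3P[_ z'A bz] zs].
    have z'D := clD.2 _ _ zD z'A bz.
    apply: connect_trans (connect1 _) (IHs _ z'D zs).
    by rewrite /bi_in /= !(subsetP sDA').
  have bD z : z \in D -> connect (bi_in G A') v z.
    rewrite {1}/D disS1 inE => /andP[_ /connectP[s sp ->]]; exact: pathD.
  by move=> uD wD; rewrite (connect_trans _ (bD _ wD)) // bi_in_sym bD.
(* If D generates A, its barren part is a head generating A as well. *)
have [eA|neA] := eqVneq A' A.
  have D0 : D != set0 by apply/set0Pn; exists v.
  pose H : Defs.head G := exist _ (barren G D) (barren_head D0 connD).
  have eH : anS G (val H) = A by rewrite /= anS_barren.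
  have sHA : val H \subset A by rewrite -eH sub_anS.
  have chH h : h \in val H -> childless G A h.
    by rewrite -eH; apply: head_childless (valP H).
  have [h hH] := set0Pn _ (head_neq0 H).
  rewrite -eH; apply: marg_head; rewrite eH; [move=> u uH y|move=> y]; apply: IHn.
  - exact: ancestralD1 ancA (chH _ uH).
  - by apply: properD1; apply: (subsetP sHA).
  - exact: ancestralD.
  - apply/properP; split; first exact: subsetDl.
    by exists h; [exact: (subsetP sHA _ hH)|rewrite in_setD hH].
have pA' : A' \proper A by rewrite properEneq neA.
have chv' : childless G A' v by move=> w wA'; apply/chv/(subsetP sA'A).
have clD' : bi_closed G A' D.
  by split=> // u w uD wA'; apply: clD.2 => //; apply: (subsetP sA'A).
have eD : disS G A' [set v] = D.
  apply/eqP; rewrite eqEsubset (disS_min clD) ?sub1set //=.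
  apply/subsetP=> w wD; rewrite disS1 inE (subsetP sDA') //=; exact: connD.
have ch1 B : childless G B v -> forall h, h \in [set v] -> childless G B h.
  by move=> chB h /set1P->.
have v0 : [set v] != set0 by apply/set0Pn; exists v; rewrite set11.
(* The blanket of v is the same in A and in A', since D is a district of both. *)
have := local_markov ancA sv (ch1 _ chv) x v0 pM.
have sv' : [set v] \subset A' by rewrite sub1set.
have := local_markov ancA' sv' (ch1 _ chv') x v0 pM.
rewrite eD -/D; set C := (D :|: _) :\: _ => e' e.
have ancAv := ancestralD1 ancA chv; have ancAv' := ancestralD1 ancA' chv'.
have := marg_neq0 A' x; rewrite (IHn A') // (expansion_closedD _ _ ancA' clD') in e' *.
rewrite mulf_eq0 negb_or => /andP[_ k'0].
rewrite (IHn (A' :\ v)) // in e'; last exact: sub_proper_trans (subD1set _ _) pA'.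
rewrite (IHn (A :\ v)) ?properD1 // in e.
rewrite (expansion_closedD1 _ _ ancA' clD' vD) in e'.
rewrite (expansion_closedD1 _ _ ancA clD vD) in e.
rewrite (expansion_closedD _ _ ancA clD).
apply: (mulIf (marg_neq0 C x)); rewrite e mulrA [RHS]mulrAC; congr (_ * _).
by apply: (mulIf k'0); rewrite -mulrA -e' mulrAC.
Qed.

End Necessity.

Theorem theorem6p2 (R : realType) (V : finType) (G : admg V) (q : params R G) :
  derived q <-> forall x : state V, 0 < prob_of q x.
Proof.
split=> [[p pM qE] x|]; last exact: derived_prob_of.
rewrite prob_ofE -(marg_expansion pM qE _ (@ancestralT _ G)) margT.
by have [] := pM.
Qed.
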